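(* Let $0,1,r,s,t\in\mathbb{C}$ be pairwise distinct and let $(R,S,T,c_r,c_s,c_t)\in\mathbb{C}^6$. Then, with $\Theta_r,\Theta_s,\Theta_t$ the Higgs fields defined in the context, $$-\det(c_r\Theta_r+c_s\Theta_s+c_t\Theta_t)=(h_2x^2+h_1x+h_0)\frac{(\mathrm{d}x)^{\otimes2}}{x(x-1)(x-r)(x-s)(x-t)},$$ where $$h_0=\big(c_r(R-1)+c_s(S-1)+c_t(T-1)\big)\big(c_rst(R-r)R+c_srt(S-s)S+c_trs(T-t)T\big),$$ $$h_2=\big(c_r(R-1)R+c_s(S-1)S+c_t(T-1)T\big)\big(c_r(R-r)+c_s(S-s)+c_t(T-t)\big),$$ $$\begin{aligned} h_1=\;&c_r\big(c_r(s+t)(r+1)+c_ss(t+1)+c_tt(s+1)\big)R^2-c_r^2(t+s)R^3\\ &+c_s\big(c_s(r+t)(s+1)+c_rr(t+1)+c_tt(r+1)\big)S^2-c_s^2(t+r)S^3\\ &+c_t\big(c_t(r+s)(t+1)+c_rr(s+1)+c_ss(r+1)\big)T^2-c_t^2(r+s)T^3\\ &-c_rc_s\big(t(R-1+S-1)+r(S-s)+s(R-r)\big)RS\\ &-c_rc_t\big(s(R-1+T-1)+r(T-t)+t(R-r)\big)RT\\ &-c_sc_t\big(r(S-1+T-1)+s(T-t)+t(S-s)\big)ST\\ &-\big(c_tt(r+s)+c_rr(s+t)+c_ss(r+t)\big)(c_rR+c_sS+c_tT).\end{aligned}$$ Moreover these functions Poisson-commute: for all $f,g\in\{h_0,h_1,h_2\}$,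 $$\sum_{i\in\{r,s,t\}}\left(\frac{\partial f}{\partial p_i}\frac{\partial g}{\partial q_i}-\frac{\partial f}{\partial q_i}\frac{\partial g}{\partial p_i}\right)=0,\qquad (p_r,p_s,p_t,q_r,q_s,q_t):=(R,S,T,c_r,c_s,c_t).$$
   Context: For $(i,z_i)\in\{(r,R),(s,S),(t,T)\}$, $\Theta_i$ is the matrix of meromorphic $1$-forms on $\mathbb{P}^1_x$ $$\Theta_i=\begin{pmatrix} 0 & 0 \\ 1-z_i & 0 \end{pmatrix}\frac{\mathrm{d}x}{x}+\begin{pmatrix} z_i & -z_i \\ z_i & -z_i \end{pmatrix}\frac{\mathrm{d}x}{x-1}+\begin{pmatrix} -z_i & z_i^2 \\ -1 & z_i \end{pmatrix}\frac{\mathrm{d}x}{x-i},$$ which represents, in the affine chart $x\neq\infty$, a logarithmic Higgs field on $\mathcal{O}_{\mathbb{P}^1}(-1)\oplus\mathcal{O}_{\mathbb{P}^1}(-2)$ with nilpotent residues. Here $\det\begin{pmatrix} \alpha & \beta \\ \gamma & -\alpha \end{pmatrix}=-(\alpha\otimes\alpha+\beta\otimes\gamma)$ is a quadratic differential. These $h_0,h_1,h_2$ are the Hitchin Hamiltonians in the coordinates $(R,S,T,c_r,c_s,c_t)$ of the cotangent space of the moduli space of parabolic bundles. *)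

(* Defs.v *)
From HB Require Import structures.
From mathcomp Require Import all_boot all_order all_algebra.
From mathcomp Require Import all_classical all_reals all_analysis.
From mathcomp Require Import complex.

Set Implicit Arguments.
Unset Strict Implicit.
Unset Printing Implicit Defensive.

Import Order.TTheory GRing.Theory Num.Theory.
Import numFieldNormedType.Exports.

Local Open Scope ring_scope.

Section MeromorphicDifferentials.
Variable F : fieldType.

(* The function field of P^1_x over F. *)
Definition ratfun := {fraction {poly F}}.

Definition ratC (a : F) : ratfun := tofrac a%:P.
Definition ratX : ratfun := tofrac 'X.

(* The meromorphic sections of the k-th tensor power of the cotangent bundle of
   P^1_x form a one-dimensional space over the function field, with basis
   (dx)^{\otimes k}: the element g stands for g (dx)^{\otimes k}. *)
Definition mdiff (k : nat) := ratfun^o.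

Definition dx : mdiff 1 := (1 : ratfun).

Definition tens k l (u : mdiff k) (v : mdiff l) : mdiff (k + l) :=
  (u : ratfun) * (v : ratfun).

(* dx / (x - a) *)
Definition dlog (a : F) : mdiff 1 := (ratX - ratC a)^-1 *: dx.

(* A (x) w, for a constant matrix A and a form w. *)
Definition mxform n (A : 'M[F]_n) (w : mdiff 1) : 'M[mdiff 1]_n :=
  \matrix_(i, j) (ratC (A i j) *: w).

Definition scalemxform n (c : F) (M : 'M[mdiff 1]_n) : 'M[mdiff 1]_n :=
  \matrix_(i, j) (ratC c *: M i j).

Definition mx2 (a b c d : F) : 'M[F]_2 :=
  \matrix_(i, j) if i == 0 then (if j == 0 then a else b)
                 else (if j == 0 then c else d).

Definition det_form (M : 'M[mdiff 1]_2) : mdiff 2 :=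
  tens (M 0 0) (M 1 1) - tens (M 0 1) (M 1 0).

Lemma det_form_traceless (M : 'M[mdiff 1]_2) : M 1 1 = - M 0 0 ->
  det_form M = - (tens (M 0 0) (M 0 0) + tens (M 0 1) (M 1 0)).
Proof. by rewrite /det_form /tens => ->; rewrite mulrN -opprD. Qed.

Definition Theta (i z : F) : 'M[mdiff 1]_2 :=
    mxform (mx2    0      0
                (1 - z)   0) (dlog 0)
  + mxform (mx2    z    (- z)
                   z    (- z)) (dlog 1)
  + mxform (mx2  (- z)  (z ^+ 2)
                 (- 1)     z) (dlog i).

End MeromorphicDifferentials.

(* The complex numbers are R[i], for R : realType. *)
Section PhaseSpace.
Variable R : realType.
Local Notation C := R[i].

(* Points are (p_r, p_s, p_t, q_r, q_s, q_t) = (R, S, T, c_r, c_s, c_t). *)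
Definition phase := 'rV[C]_(3 + 3).

Definition pcoord (i : 'I_3) (v : phase) : C := v 0 (lshift 3 i).
Definition qcoord (i : 'I_3) (v : phase) : C := v 0 (rshift 3 i).

Definition coordR : phase -> C := pcoord (@Ordinal 3 0 isT).
Definition coordS : phase -> C := pcoord (@Ordinal 3 1 isT).
Definition coordT : phase -> C := pcoord (@Ordinal 3 2 isT).
Definition coord_cr : phase -> C := qcoord (@Ordinal 3 0 isT).
Definition coord_cs : phase -> C := qcoord (@Ordinal 3 1 isT).
Definition coord_ct : phase -> C := qcoord (@Ordinal 3 2 isT).

(* Derivatives over the normed field C, hence complex partial derivatives, in the
   directions of the standard basis. *)
Definition dp (i : 'I_3) (f : phase -> C) (v : phase) : C :=
  'D_(delta_mx 0 (lshift 3 i) : phase) (f : phase -> C^o) v.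
Definition dq (i : 'I_3) (f : phase -> C) (v : phase) : C :=
  'D_(delta_mx 0 (rshift 3 i) : phase) (f : phase -> C^o) v.

Definition poisson (f g : phase -> C) (v : phase) : C :=
  \sum_(i < 3) (dp i f v * dq i g v - dq i f v * dp i g v).

Definition higgs (r s t : C) (v : phase) : 'M[mdiff C 1]_2 :=
    scalemxform (coord_cr v) (Theta r (coordR v))
  + scalemxform (coord_cs v) (Theta s (coordS v))
  + scalemxform (coord_ct v) (Theta t (coordT v)).

Definition h0 (r s t : C) (v : phase) : C :=
  let R := coordR v in let S := coordS v in let T := coordT v in
  let cr := coord_cr v in let cs := coord_cs v in let ct := coord_ct v in
  (cr * (R - 1) + cs * (S - 1) + ct * (T - 1)) *
  (cr * s * t * (R - r) * R + cs * r * t * (S - s) * S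
   + ct * r * s * (T - t) * T).

Definition h2 (r s t : C) (v : phase) : C :=
  let R := coordR v in let S := coordS v in let T := coordT v in
  let cr := coord_cr v in let cs := coord_cs v in let ct := coord_ct v in
  (cr * (R - 1) * R + cs * (S - 1) * S + ct * (T - 1) * T) *
  (cr * (R - r) + cs * (S - s) + ct * (T - t)).

Definition h1 (r s t : C) (v : phase) : C :=
  let R := coordR v in let S := coordS v in let T := coordT v in
  let cr := coord_cr v in let cs := coord_cs v in let ct := coord_ct v in
    cr * (cr * (s + t) * (r + 1) + cs * s * (t + 1) + ct * t * (s + 1)) * R ^+ 2
  - cr ^+ 2 * (t + s) * R ^+ 3
  + cs * (cs * (r + t) * (s + 1) + cr * r * (t + 1) + ct * t * (r + 1)) * S ^+ 2
  - cs ^+ 2 * (t + r) * S ^+ 3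
  + ct * (ct * (r + s) * (t + 1) + cr * r * (s + 1) + cs * s * (r + 1)) * T ^+ 2
  - ct ^+ 2 * (r + s) * T ^+ 3
  - cr * cs * (t * (R - 1 + S - 1) + r * (S - s) + s * (R - r)) * R * S
  - cr * ct * (s * (R - 1 + T - 1) + r * (T - t) + t * (R - r)) * R * T
  - cs * ct * (r * (S - 1 + T - 1) + s * (T - t) + t * (S - s)) * S * T
  - (ct * t * (r + s) + cr * r * (s + t) + cs * s * (r + t))
    * (cr * R + cs * S + ct * T).

End PhaseSpace.

(* Main.v *)
Require Import Defs.
From HB Require Import structures.
From mathcomp Require Import all_boot all_order all_algebra.
From mathcomp Require Import all_classical all_reals all_analysis.
From mathcomp Require Import complex.
From mathcomp Require Import ring.

Import Order.TTheory GRing.Theory Num.Theory.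
Import numFieldNormedType.Exports.

Local Open Scope ring_scope.

(** Each Theta_i is traceless, so minus the determinant is [a ^+ 2 + b * c] for
    the entries a, b, c of the Higgs field, and the first claim is an identity in
    the field C(x), valid because x - a is never 0 there. The Hamiltonians are
    invariant under simultaneous permutations of the triples (r, R, c_r),
    (s, S, c_s), (t, T, c_t); hence the two partial derivatives in R and c_r
    determine all six, and the Poisson brackets are polynomial identities. *)

(** * The Hamiltonians and their brackets as polynomials in nine variables *)

Section Hamiltonians.
Context {A : comNzRingType}.
Implicit Types r s t R S T cr cs ct : A.

(** Scalars range over any commutative ring, so that one formula serves over the constants and over
    the rational functions; [h0] is its value at the coordinates of a point. The same holds for
    [ham1] and [ham2]. *)
Definition ham0 r s t R S T cr cs ct : A :=
  (cr * (R - 1) + cs * (S - 1) + ct * (T - 1)) *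
  (cr * s * t * (R - r) * R + cs * r * t * (S - s) * S
   + ct * r * s * (T - t) * T).

Definition ham2 r s t R S T cr cs ct : A :=
  (cr * (R - 1) * R + cs * (S - 1) * S + ct * (T - 1) * T) *
  (cr * (R - r) + cs * (S - s) + ct * (T - t)).

Definition ham1 r s t R S T cr cs ct : A :=
    cr * (cr * (s + t) * (r + 1) + cs * s * (t + 1) + ct * t * (s + 1)) * R ^+ 2
  - cr ^+ 2 * (t + s) * R ^+ 3
  + cs * (cs * (r + t) * (s + 1) + cr * r * (t + 1) + ct * t * (r + 1)) * S ^+ 2
  - cs ^+ 2 * (t + r) * S ^+ 3
  + ct * (ct * (r + s) * (t + 1) + cr * r * (s + 1) + cs * s * (r + 1)) * T ^+ 2
  - ct ^+ 2 * (r + s) * T ^+ 3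
  - cr * cs * (t * (R - 1 + S - 1) + r * (S - s) + s * (R - r)) * R * S
  - cr * ct * (s * (R - 1 + T - 1) + r * (T - t) + t * (R - r)) * R * T
  - cs * ct * (r * (S - 1 + T - 1) + s * (T - t) + t * (S - s)) * S * T
  - (ct * t * (r + s) + cr * r * (s + t) + cs * s * (r + t))
    * (cr * R + cs * S + ct * T).

(* [hamk_p] and [hamk_q] are the partial derivatives of [hamk] in R and c_r. *)
Definition ham0_p r s t R S T cr cs ct : A :=
  cr * (cr * s * t * (R - r) * R + cs * r * t * (S - s) * S
        + ct * r * s * (T - t) * T)
  + (cr * (R - 1) + cs * (S - 1) + ct * (T - 1)) * (cr * s * t * (2 * R - r)).

Definition ham0_q r s t R S T cr cs ct : A :=
  (R - 1) * (cr * s * t * (R - r) * R + cs * r * t * (S - s) * S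
             + ct * r * s * (T - t) * T)
  + (cr * (R - 1) + cs * (S - 1) + ct * (T - 1)) * (s * t * (R - r) * R).

Definition ham2_p r s t R S T cr cs ct : A :=
  cr * (2 * R - 1) * (cr * (R - r) + cs * (S - s) + ct * (T - t))
  + (cr * (R - 1) * R + cs * (S - 1) * S + ct * (T - 1) * T) * cr.

Definition ham2_q r s t R S T cr cs ct : A :=
  (R - 1) * R * (cr * (R - r) + cs * (S - s) + ct * (T - t))
  + (cr * (R - 1) * R + cs * (S - 1) * S + ct * (T - 1) * T) * (R - r).

Definition ham1_p r s t R S T cr cs ct : A :=
  2 * cr * (cr * (s + t) * (r + 1) + cs * s * (t + 1) + ct * t * (s + 1)) * R
  - 3 * cr ^+ 2 * (t + s) * R ^+ 2
  - cr * cs * (t * (2 * R + S - 2) + r * (S - s) + s * (2 * R - r)) * S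
  - cr * ct * (s * (2 * R + T - 2) + r * (T - t) + t * (2 * R - r)) * T
  - cr * (ct * t * (r + s) + cr * r * (s + t) + cs * s * (r + t)).

Definition ham1_q r s t R S T cr cs ct : A :=
  (2 * cr * (s + t) * (r + 1) + cs * s * (t + 1) + ct * t * (s + 1)) * R ^+ 2
  - 2 * cr * (t + s) * R ^+ 3
  + cs * r * (t + 1) * S ^+ 2 + ct * r * (s + 1) * T ^+ 2
  - cs * (t * (R - 1 + S - 1) + r * (S - s) + s * (R - r)) * R * S
  - ct * (s * (R - 1 + T - 1) + r * (T - t) + t * (R - r)) * R * T
  - r * (s + t) * (cr * R + cs * S + ct * T)
  - (ct * t * (r + s) + cr * r * (s + t) + cs * s * (r + t)) * R.
(** The Poisson bracket of two functions invariant under permutation of the triples: the partials in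
    [S], [cs] come from [fp], [fq] by exchanging the first two triples, those in [T], [ct] by
    exchanging the first and the third. *)
Definition partials_bracket
    (fp fq gp gq : A -> A -> A -> A -> A -> A -> A -> A -> A -> A)
    r s t R S T cr cs ct : A :=
    (fp r s t R S T cr cs ct * gq r s t R S T cr cs ct
     - fq r s t R S T cr cs ct * gp r s t R S T cr cs ct)
  + (fp s r t S R T cs cr ct * gq s r t S R T cs cr ct
     - fq s r t S R T cs cr ct * gp s r t S R T cs cr ct)
  + (fp t s r T S R ct cs cr * gq t s r T S R ct cs cr
     - fq t s r T S R ct cs cr * gp t s r T S R ct cs cr).

Lemma partials_bracket_ham01 r s t R S T cr cs ct :
  partials_bracket ham0_p ham0_q ham1_p ham1_q r s t R S T cr cs ct = 0.
Proof. rewrite /partials_bracket /ham0_p /ham0_q /ham1_p /ham1_q; ring. Qed.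

Lemma partials_bracket_ham02 r s t R S T cr cs ct :
  partials_bracket ham0_p ham0_q ham2_p ham2_q r s t R S T cr cs ct = 0.
Proof. rewrite /partials_bracket /ham0_p /ham0_q /ham2_p /ham2_q; ring. Qed.

Lemma partials_bracket_ham12 r s t R S T cr cs ct :
  partials_bracket ham1_p ham1_q ham2_p ham2_q r s t R S T cr cs ct = 0.
Proof. rewrite /partials_bracket /ham1_p /ham1_q /ham2_p /ham2_q; ring. Qed.

End Hamiltonians.

Section Morphisms.
Variables (A B : comNzRingType) (f : {rmorphism A -> B}).

(** A polynomial with integer coefficients commutes with ring morphisms; with [ratC] for [f], this
    turns Hamiltonians of constant rational functions back into constants. *)
Lemma rmorph_ham0 r s t R S T cr cs ct :
  f (ham0 r s t R S T cr cs ct) =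
  ham0 (f r) (f s) (f t) (f R) (f S) (f T) (f cr) (f cs) (f ct).
Proof. by rewrite /ham0 !(rmorphM, rmorphD, rmorphN, rmorph1). Qed.

Lemma rmorph_ham1 r s t R S T cr cs ct :
  f (ham1 r s t R S T cr cs ct) =
  ham1 (f r) (f s) (f t) (f R) (f S) (f T) (f cr) (f cs) (f ct).
Proof. by rewrite /ham1 !(rmorphM, rmorphXn, rmorphD, rmorphN, rmorph1). Qed.

Lemma rmorph_ham2 r s t R S T cr cs ct :
  f (ham2 r s t R S T cr cs ct) =
  ham2 (f r) (f s) (f t) (f R) (f S) (f T) (f cr) (f cs) (f ct).
Proof. by rewrite /ham2 !(rmorphM, rmorphD, rmorphN, rmorph1). Qed.

End Morphisms.

(** * The determinant identity over a field *)

Section HiggsEntries.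
Context {K : fieldType}.
Implicit Types x i z : K.

(** Coefficients of [dx] in the entries of [Theta i z]; the remaining entry is the opposite of
    [theta00]. *)
Definition theta00 x i z := z / (x - 1) - z / (x - i).
Definition theta01 x i z := z ^+ 2 / (x - i) - z / (x - 1).
Definition theta10 x i z := (1 - z) / x + z / (x - 1) - 1 / (x - i).

(** For distinct poles, nilpotency of the residues cancels every double pole, and the left side is
    of order [x ^- 3] at infinity, which leaves a numerator of degree at most 2. The proof only
    clears denominators and compares polynomials. *)
Lemma spectral_identity x r s t R S T cr cs ct :
  x != 0 -> x - 1 != 0 -> x - r != 0 -> x - s != 0 -> x - t != 0 ->
  (cr * theta00 x r R + cs * theta00 x s S + ct * theta00 x t T) ^+ 2
  + (cr * theta01 x r R + cs * theta01 x s S + ct * theta01 x t T)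
    * (cr * theta10 x r R + cs * theta10 x s S + ct * theta10 x t T)
  = (ham2 r s t R S T cr cs ct * x ^+ 2 + ham1 r s t R S T cr cs ct * x
     + ham0 r s t R S T cr cs ct)
    / (x * (x - 1) * (x - r) * (x - s) * (x - t)).
Proof.
move=> x0 x1 xr xs xt; rewrite /theta00 /theta01 /theta10 /ham0 /ham1 /ham2.
by field; rewrite x0 x1 xr xs xt.
Qed.

End HiggsEntries.

(** * Entries of the Higgs fields as rational functions *)

Section RationalFunctions.
Variable F : fieldType.

Fact ratC_is_zmod_morphism : zmod_morphism (@ratC F).
Proof. by move=> a b; rewrite /ratC !rmorphB. Qed.

Fact ratC_is_monoid_morphism : monoid_morphism (@ratC F).
Proof. by split=> [|a b]; rewrite /ratC ?rmorph1 // !rmorphM. Qed.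

HB.instance Definition _ :=
  GRing.isZmodMorphism.Build F (ratfun F) (@ratC F) ratC_is_zmod_morphism.
HB.instance Definition _ :=
  GRing.isMonoidMorphism.Build F (ratfun F) (@ratC F) ratC_is_monoid_morphism.

Lemma ratX_neq_ratC (a : F) : ratX F - ratC a != 0.
Proof. by rewrite /ratX /ratC -rmorphB tofrac_eq0 polyXsubC_eq0. Qed.

(** Moves the constants into the function field, so that the matrices on the right have entries in
    [ratfun F] and scaling of forms becomes multiplication. *)
Lemma ThetaE (i z : F) j k :
  Theta i z j k =
  mx2 0 0 (1 - ratC z) 0 j k / ratX F
  + mx2 (ratC z) (- ratC z) (ratC z) (- ratC z) j k / (ratX F - 1)
  + mx2 (- ratC z) (ratC z ^+ 2) (- 1) (ratC z) j k / (ratX F - ratC i)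
  :> ratfun F.
Proof.
rewrite /Theta 2!mxE /mxform !(mxE _ _ j k) /dlog /dx rmorph0 subr0 rmorph1.
rewrite !(fun_if (@ratC F)) !(rmorph0, rmorph1, rmorphB, rmorphN, rmorphXn).
by rewrite /GRing.scale /= !mulr1.
Qed.

Lemma Theta00 (i z : F) :
  Theta i z 0 0 = theta00 (ratX F) (ratC i) (ratC z).
Proof. by rewrite ThetaE !mxE /= mul0r add0r mulNr. Qed.

Lemma Theta01 (i z : F) :
  Theta i z 0 1 = theta01 (ratX F) (ratC i) (ratC z).
Proof. by rewrite ThetaE !mxE /= mul0r add0r mulNr addrC. Qed.

Lemma Theta10 (i z : F) :
  Theta i z 1 0 = theta10 (ratX F) (ratC i) (ratC z).
Proof. by rewrite ThetaE !mxE /= mulNr. Qed.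

Lemma Theta11 (i z : F) :
  Theta i z 1 1 = - theta00 (ratX F) (ratC i) (ratC z).
Proof. by rewrite ThetaE !mxE /= mul0r add0r mulNr opprB addrC. Qed.

End RationalFunctions.

(** * The determinant of the combined Higgs field *)

Section Spectral.
Context {F : fieldType}.
Variables (r s t R S T cr cs ct : F).

Let M := scalemxform cr (Theta r R) + scalemxform cs (Theta s S)
         + scalemxform ct (Theta t T).

Lemma higgsE j k :
  M j k = ratC cr * (Theta r R j k : ratfun F)
          + ratC cs * (Theta s S j k : ratfun F)
          + ratC ct * (Theta t T j k : ratfun F).
Proof. by rewrite /M 2!mxE /scalemxform !(mxE _ _ j k). Qed.

Lemma det_higgs (x := ratX F) :
  - det_form M =
  ((ratC (ham2 r s t R S T cr cs ct) * x ^+ 2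
    + ratC (ham1 r s t R S T cr cs ct) * x
    + ratC (ham0 r s t R S T cr cs ct))
   / (x * (x - 1) * (x - ratC r) * (x - ratC s) * (x - ratC t)))
  *: tens (dx F) (dx F).
Proof.
have x_neq a : x - ratC a != 0 by exact: ratX_neq_ratC.
have x0 : x != 0 by have := x_neq 0; rewrite rmorph0 subr0.
have x1 : x - 1 != 0 by have := x_neq 1; rewrite rmorph1.
have M11 : M 1 1 = - M 0 0.
  by rewrite !higgsE !Theta00 !Theta11 !mulrN -!opprD.
rewrite det_form_traceless // opprK /tens !higgsE !Theta00 !Theta01 !Theta10.
rewrite /dx mulr1 /GRing.scale /= mulr1.
have := spectral_identity x (ratC r) (ratC s) (ratC t) (ratC R) (ratC S)
  (ratC T) (ratC cr) (ratC cs) (ratC ct) x0 x1 (x_neq r) (x_neq s) (x_neq t).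
(* The identity has Hamiltonians evaluated at images under [ratC]; folding them gives the constant
   coefficients of the goal. *)
rewrite -(rmorph_ham0 _ _ (@ratC F)) -(rmorph_ham1 _ _ (@ratC F)).
by rewrite -(rmorph_ham2 _ _ (@ratC F)) expr2 => ->.
Qed.

End Spectral.

(** * Directional derivatives of the coordinates and the Hamiltonians *)

Lemma is_derive_coord (K : numFieldType) n (j : 'I_n.+1) (v w : 'rV[K]_n.+1) :
  is_derive v w ((fun u : 'rV[K]_n.+1 => u 0 j) : 'rV[K]_n.+1 -> K^o) (w 0 j).
Proof.
have cvgj : (h^-1 *: ((h *: w + v) 0 j - v 0 j : K^o)
    @[h --> (0 : K)^'] --> (w 0 j : K^o))%classic.
  (* By linearity the difference quotient equals [w 0 j] for every nonzero [h], hence on a punctured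
     neighbourhood of 0. *)
  apply: cvg_near_cst; near=> h.
  have h0 : h != 0 by near: h; exact: nbhs_dnbhs_neq.
  by rewrite !mxE addrK /GRing.scale /= mulKf.
apply: DeriveDef; first by apply/cvg_ex; exists (w 0 j).
exact: cvg_lim cvgj.
Unshelve. all: by end_near.
Qed.

Section Gradients.
Variables (K : numFieldType) (V : normedModType K) (r s t : K).
Variables (R S T cr cs ct : V -> K) (v w : V) (dR dS dT dcr dcs dct : K).
Hypotheses (hR : is_derive v w (R : V -> K^o) dR)
  (hS : is_derive v w (S : V -> K^o) dS)
  (hT : is_derive v w (T : V -> K^o) dT)
  (hcr : is_derive v w (cr : V -> K^o) dcr)
  (hcs : is_derive v w (cs : V -> K^o) dcs)
  (hct : is_derive v w (ct : V -> K^o) dct).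

(** The chain rule for a symmetric function, with all six partials obtained from [fp] and [fq] by
    exchanging triples. *)
Definition gradient
    (fp fq : K -> K -> K -> K -> K -> K -> K -> K -> K -> K) : K :=
    fp r s t (R v) (S v) (T v) (cr v) (cs v) (ct v) * dR
  + fp s r t (S v) (R v) (T v) (cs v) (cr v) (ct v) * dS
  + fp t s r (T v) (S v) (R v) (ct v) (cs v) (cr v) * dT
  + fq r s t (R v) (S v) (T v) (cr v) (cs v) (ct v) * dcr
  + fq s r t (S v) (R v) (T v) (cs v) (cr v) (ct v) * dcs
  + fq t s r (T v) (S v) (R v) (ct v) (cs v) (cr v) * dct.

Local Notation along ham :=
  ((fun u => ham r s t (R u) (S u) (T u) (cr u) (cs u) (ct u)) : V -> K^o).

(** Instance resolution assembles a derivative from the sum and product rules; [ring] then matches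
    it with [gradient], which also checks the symmetry behind the exchanged arguments. *)
Lemma is_derive_ham0 :
  is_derive v w (along ham0) (gradient ham0_p ham0_q).
Proof.
rewrite /ham0; apply: is_derive_eq.
rewrite /gradient /ham0_p /ham0_q /GRing.scale /=; ring.
Qed.

Lemma is_derive_ham2 :
  is_derive v w (along ham2) (gradient ham2_p ham2_q).
Proof.
rewrite /ham2; apply: is_derive_eq.
rewrite /gradient /ham2_p /ham2_q /GRing.scale /=; ring.
Qed.

Lemma is_derive_ham1 :
  is_derive v w (along ham1) (gradient ham1_p ham1_q).
Proof.
rewrite /ham1; apply: is_derive_eq.
rewrite /gradient /ham1_p /ham1_q /GRing.scale /=; ring.
Qed.

End Gradients.

(** * Poisson brackets on phase space *)

Section PhaseSpace.
Variables (R : realType) (r s t : R[i]) (v : phase R).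

Let grad (w : phase R) :=
  @gradient R[i] (phase R) r s t (@coordR R) (@coordS R) (@coordT R)
    (@coord_cr R) (@coord_cs R) (@coord_ct R) v
    (coordR w) (coordS w) (coordT w) (coord_cr w) (coord_cs w) (coord_ct w).

Lemma is_derive_h0 w :
  is_derive v w (h0 r s t : phase R -> R[i]^o) (grad w ham0_p ham0_q).
Proof. by apply: is_derive_ham0; exact: is_derive_coord. Qed.

Lemma is_derive_h1 w :
  is_derive v w (h1 r s t : phase R -> R[i]^o) (grad w ham1_p ham1_q).
Proof. by apply: is_derive_ham1; exact: is_derive_coord. Qed.

Lemma is_derive_h2 w :
  is_derive v w (h2 r s t : phase R -> R[i]^o) (grad w ham2_p ham2_q).
Proof. by apply: is_derive_ham2; exact: is_derive_coord. Qed.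

(** Along a basis vector exactly one of the six coordinate derivatives is 1 and the others are 0, so
    [grad] reduces to a single partial derivative. *)
Lemma poisson_partials (f g : phase R -> R[i]) fp fq gp gq :
  (forall w, is_derive v w (f : phase R -> R[i]^o) (grad w fp fq)) ->
  (forall w, is_derive v w (g : phase R -> R[i]^o) (grad w gp gq)) ->
  poisson f g v =
  partials_bracket fp fq gp gq r s t (coordR v) (coordS v) (coordT v)
    (coord_cr v) (coord_cs v) (coord_ct v).
Proof.
move=> df dg.
have dpE i : dp i f v = grad (delta_mx 0 (lshift 3 i)) fp fq.
  by have [_] := df (delta_mx 0 (lshift 3 i)).
have dqE i : dq i f v = grad (delta_mx 0 (rshift 3 i)) fp fq.
  by have [_] := df (delta_mx 0 (rshift 3 i)).
have dpE' i : dp i g v = grad (delta_mx 0 (lshift 3 i)) gp gq.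
  by have [_] := dg (delta_mx 0 (lshift 3 i)).
have dqE' i : dq i g v = grad (delta_mx 0 (rshift 3 i)) gp gq.
  by have [_] := dg (delta_mx 0 (rshift 3 i)).
rewrite /poisson !big_ord_recl big_ord0 !dpE !dqE !dpE' !dqE' /grad /gradient.
rewrite /coordR /coordS /coordT /coord_cr /coord_cs /coord_ct /pcoord /qcoord.
rewrite ![delta_mx _ _ _ _]mxE !eqE /= !(mulr0, mulr1) !(addr0, add0r).
rewrite addrA /partials_bracket.
by congr +%R.
Qed.

Lemma poissonxx (f : phase R -> R[i]) : poisson f f v = 0.
Proof.
rewrite /poisson big1 // => i _.
by move: (dp i f v) (dq i f v) => a b; rewrite [b * a]mulrC subrr.
Qed.

Lemma poissonC (f g : phase R -> R[i]) : poisson g f v = - poisson f g v.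
Proof.
rewrite /poisson -sumrN; apply: eq_bigr => i _.
move: (dp i f v) (dq i f v) (dp i g v) (dq i g v) => a b c d.
by rewrite opprB [c * b]mulrC [d * a]mulrC.
Qed.

Lemma poisson_h0_h1 : poisson (h0 r s t) (h1 r s t) v = 0.
Proof.
by rewrite (poisson_partials _ _ _ _ _ _ is_derive_h0 is_derive_h1) partials_bracket_ham01.
Qed.

Lemma poisson_h0_h2 : poisson (h0 r s t) (h2 r s t) v = 0.
Proof.
by rewrite (poisson_partials _ _ _ _ _ _ is_derive_h0 is_derive_h2) partials_bracket_ham02.
Qed.

Lemma poisson_h1_h2 : poisson (h1 r s t) (h2 r s t) v = 0.
Proof.
by rewrite (poisson_partials _ _ _ _ _ _ is_derive_h1 is_derive_h2) partials_bracket_ham12.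
Qed.

End PhaseSpace.

Theorem mainTheorem3 (R : realType) (r s t : R[i])
    (hdist : uniq [:: 0; 1; r; s; t]) :
  (forall v : phase R,
     let x := ratX R[i] in
     - det_form (higgs r s t v) =
       ((ratC (h2 r s t v) * x ^+ 2 + ratC (h1 r s t v) * x
           + ratC (h0 r s t v))
        / (x * (x - 1) * (x - ratC r) * (x - ratC s) * (x - ratC t)))
       *: tens (dx R[i]) (dx R[i]))
  /\
  (forall f g : phase R -> R[i],
     [set h0 r s t; h1 r s t; h2 r s t]%classic f ->
     [set h0 r s t; h1 r s t; h2 r s t]%classic g ->
     forall v : phase R, poisson f g v = 0).
Proof.
split=> [v x|f g hf hg v]; first exact: det_higgs.
(* Nine ordered pairs: the diagonal ones vanish by commutativity of the product, and antisymmetry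
   reduces the other six to three brackets. *)
case: hf => [[]|] ->; case: hg => [[]|] ->.
- exact: poissonxx.
- exact: poisson_h0_h1.
- exact: poisson_h0_h2.
- by rewrite poissonC poisson_h0_h1 oppr0.
- exact: poissonxx.
- exact: poisson_h1_h2.
- by rewrite poissonC poisson_h0_h2 oppr0.
- by rewrite poissonC poisson_h1_h2 oppr0.
- exact: poissonxx.
Qed.
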